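(* Let $r\ge 3$ be an integer. There exists a constant $C=C_r>0$, depending only on $r$, such that for every integer $k\ge 1$, every $r$-uniform hypergraph $\mathcal{H}$ with average degree at least $C k^{r-1}$ contains Berge cycles of $k$ consecutive lengths.
   Context: All hypergraphs are finite, simple (no repeated edges) and have a non-empty vertex set. An $r$-uniform hypergraph ($r$-graph) is a hypergraph all of whose edges have exactly $r$ vertices. The degree of a vertex is the number of edges containing it, and the average degree is the average of the degrees over all vertices, i.e. $r|\mathcal{E}(\mathcal{H})|/|\mathcal{V}(\mathcal{H})|$. A Berge cycle of length $\ell$ ($\ell\ge 3$) is a hypergraph consisting of $\ell$ distinct edges $e_1,\dots,e_\ell$ for which there exist $\ell$ distinct vertices $v_1,\dots,v_\ell$ with $v_i,v_{i+1}\in e_i$ for $1\le i\le \ell-1$ and $v_1,v_\ell\in e_\ell$. ''$\mathcal{H}$ contains Berge cycles of $k$ consecutive lengths'' means that there is an integer $a$ such that, for every $\ell\in\{a,a+1,\dots,a+k-1\}$, $\mathcal{H}$ contains a Berge cycle of length $\ell$ as a subhypergraph. *)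

(* Defs.v *)
From HB Require Import structures.
From mathcomp Require Import all_boot all_order all_algebra.
Set Implicit Arguments.
Unset Strict Implicit.
Unset Printing Implicit Defensive.
Import Order.TTheory GRing.Theory Num.Theory.
Local Open Scope ring_scope.

(* A simple hypergraph on the vertex set V is identified with its edge set
   H : {set {set V}}; non-emptiness of V is assumed separately. *)

Definition uniform (r : nat) (V : finType) (H : {set {set V}}) : Prop :=
  forall e : {set V}, e \in H -> #|e| = r.

Definition degree (V : finType) (H : {set {set V}}) (v : V) : nat :=
  #|[set e in H | v \in e]|.

Definition average_degree (R : realFieldType) (V : finType)
    (H : {set {set V}}) : R :=
  (\sum_(v : V) (degree H v)%:R) / #|V|%:R.

(* Indices run over 0, ..., l - 1 and ordS is the cyclic successor, so the last
   edge contains v (l - 1) and v 0. *)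
Definition is_berge_cycle (V : finType) (l : nat) (F : {set {set V}}) : Prop :=
  (3 <= l)%N /\
  exists (e : 'I_l -> {set V}) (v : 'I_l -> V),
    [/\ injective e, injective v, F = [set e i | i : 'I_l]
      & forall i : 'I_l, v i \in e i /\ v (ordS i) \in e i].

Definition contains_berge_cycle (V : finType) (H : {set {set V}})
    (l : nat) : Prop :=
  exists F : {set {set V}}, F \subset H /\ is_berge_cycle l F.

(* Berge cycles have length at least 3, so for k >= 1 nothing is lost by taking
   the first length a in nat. *)
Definition berge_cycles_of_consecutive_lengths (V : finType)
    (H : {set {set V}}) (k : nat) : Prop :=
  exists a : nat, forall l : nat, (a <= l < a + k)%N ->
    contains_berge_cycle H l.

(* Main.v *)
Require Import Defs.
From HB Require Import structures.
From mathcomp Require Import all_boot all_order all_algebra zify ring.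
Set Implicit Arguments.
Unset Strict Implicit.
Unset Printing Implicit Defensive.
Import Order.TTheory GRing.Theory Num.Theory.

(** A Berge cycle of length l is a cycle of length 2l in the incidence graph,
whose nodes are the vertices and the edges of the hypergraph, so the task is to
find cycles of k consecutive even lengths in a bipartite graph one side of
which has constant degree r. Two sources of cycles are used.

_Dense stars._ Suppose that some edges all contain a vertex z and that every
other vertex u they cover lies in more than about k^(r-2) of them. At most
k^(r-2) edges contain both z and u and otherwise stay inside a given set of k
vertices, so a walk avoiding z can always be prolonged by a fresh edge and a
fresh vertex, and it can be closed at z at any moment: all short lengths occur
([dense_star_cycles]).

_Breadth-first levels._ A hypergraph of average degree of order k^(r-1) has a
connected part which is still as dense ([dense_connected]). In this part some
set L of edges contained in two consecutive vertex levels of a breadth-first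
search is again dense ([dense_slice]); let K be a connected dense part of L.
Going down the search tree from the vertices of K in the lower level until
their branches first meet splits these vertices into two nonempty parts A and B
such that any a in A and b in B are joined below K by a path of one fixed
length ([level_fork]). It remains to find paths inside K from a vertex of B to
A of k consecutive lengths. Mark in each edge e a vertex a(e) of the lower
level; up to exchanging A and B, half of the marks are in A. Absent a dense
star, the edges marked at a given vertex can be thinned by a factor k^(r-2) so
that the remaining ones have distinct representatives x(e), that is, the pairs
(a(e), x(e)) are distinct ([peel]). About k times as many edges as vertices
remain, which form a graph on the pairs in which one can walk greedily,
alternating between marks and representatives. Such walks from a given vertex
to the marks may all have lengths of one parity. As r >= 3, each remaining edge
has a third vertex y(e), which allows one detour that changes the parity
([parity_switch]). Hence from any vertex w of the triple system all lengths
from 2 to k + 1 occur ([triple_walks]). A path of K from B that stops when it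
first meets the triple system, followed by such a walk to A and by the path
below K, is a Berge cycle, and only the length of the middle part varies
([cycles_from_triples]). The factors k^(r-2) and k lost on the way account for
the exponent r - 1. *)

(** * Peeling *)

(** Deleting, again and again, all elements that meet a node of degree between
1 and m either gets stuck, at a subfamily of large minimum degree, or ends with
the empty family. In the second case, keeping one element of each deleted batch
gives a system of distinct representatives: later elements avoid the nodes
processed before. *)
Lemma peel (E N : finType) (inc : E -> {set N}) (m : nat) (S : {set E})
    (n0 : N) :
  (exists2 S' : {set E}, S' \subset S & S' != set0 /\
     forall e n, e \in S' -> n \in inc e -> m < #|[set f in S' | n \in inc f]|)
  \/
  (exists (F : {set E}) (g : E -> N),
     [/\ F \subset S, {in F &, injective g}, {in F, forall e, g e \in inc e}
       & #|S| <= m * #|F|]).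
Proof.
have [s] := ubnP #|S|; elim: s S => // s IHs S lt_S_s.
have [->|S_neq0] := eqVneq S set0.
  right; exists set0, (fun=> n0).
  by split; rewrite ?sub0set ?cards0 // => e; rewrite inE.
have [/forallP core|] := boolP [forall e, forall n,
    (e \in S) && (n \in inc e) ==> (m < #|[set f in S | n \in inc f]|)].
  left; exists S; rewrite ?subxx //; split=> // e n eS ne.
  by have /forallP/(_ n)/implyP := core e; apply; rewrite eS.
rewrite negb_forall => /existsP[e]; rewrite negb_forall => /existsP[n].
rewrite negb_imply -leqNgt => /andP[/andP[eS ne] le_m].
set Sn := [set f in S | n \in inc f] in le_m.
have sSn : Sn \subset S by apply/subsetP=> f; rewrite inE => /andP[].
have eSn : e \in Sn by rewrite inE eS.
have cardS : #|S| = #|Sn| + #|S :\: Sn|.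
  by rewrite -(cardsID Sn S) (setIidPr sSn).
have Sn_gt0 : 0 < #|Sn| by apply/card_gt0P; exists e.
have lt_S' : #|S :\: Sn| < s by lia.
have [[S' sS' coreS']|[F [g [sF g_inj g_inc leF]]]] := IHs _ lt_S'.
  by left; exists S' => //; apply: subset_trans sS' (subsetDl _ _).
right; have sFD := subsetP sF.
have nF f : f \in F -> (f == e) = false /\ n != g f.
  move=> fF; move: (sFD f fF); rewrite !inE => /andP[nSn fS]; split.
    by apply: contraNF nSn => /eqP->; rewrite eS.
  by apply: contraNneq nSn => ->; rewrite fS g_inc.
exists (e |: F), (fun f => if f == e then n else g f); split.
- by rewrite subUset sub1set eS (subset_trans sF) ?subsetDl.
- move=> f1 f2; rewrite !inE => /orP[/eqP->|/[dup] f1F /nF[-> n1]];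
    move=> /orP[/eqP->|/[dup] f2F /nF[-> n2]] //; rewrite ?eqxx //=.
  + by move/eqP; rewrite (negPf n2).
  + by move/eqP; rewrite eq_sym (negPf n1).
  + exact: g_inj.
- by move=> f; rewrite !inE; case: eqP => [->|_] //= /g_inc.
have eF : e \notin F by apply/negP => /nF[]; rewrite eqxx.
rewrite cardsU1 eF cardS mulnDr muln1; exact: leq_add.
Qed.

(** * The incidence graph of a hypergraph *)

Definition incidence (V : finType) (H : {set {set V}}) : rel (V + {set V}) :=
  fun p q => match p, q with
  | inl v, inr e | inr e, inl v => (e \in H) && (v \in e)
  | _, _ => false
  end.

Lemma incidence_sym (V : finType) (H : {set {set V}}) :
  symmetric (incidence H).
Proof. by move=> [u|e] [v|f]. Qed.

Lemma incidence_sub (V : finType) (K H : {set {set V}}) :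
  K \subset H -> subrel (incidence K) (incidence H).
Proof.
by move=> /subsetP sKH [u|e] [v|f] //= /andP[/sKH-> ->].
Qed.

Definition is_edge (V : finType) (p : V + {set V}) : bool :=
  if p is inr _ then true else false.

Lemma incidence_alternates (V : finType) (H : {set {set V}}) p q :
  incidence H p q -> is_edge q = ~~ is_edge p.
Proof. by case: p q => [u|e] [v|f]. Qed.

Lemma incidence_path_parity (V : finType) (H : {set {set V}}) p
    (s : seq (V + {set V})) :
  path (incidence H) p s -> is_edge (last p s) = odd (size s) (+) is_edge p.
Proof.
elim: s p => [|q s IHs] p //= /andP[/incidence_alternates pq /IHs->].
by rewrite pq addNb addbN.
Qed.

Lemma berge_of_incidence_cycle (V : finType) (H : {set {set V}}) l v
    (s : seq (V + {set V})) :
  2 < l -> size s = l.*2.-1 -> uniq (inl v :: s) ->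
  cycle (incidence H) (inl v :: s) -> contains_berge_cycle H l.
Proof.
move=> l_gt2 size_s uniq_s; rewrite /cycle => path_s.
pose t := inl v :: rcons s (inl v).
pose node := nth (inl v) t.
have size_t : size t = l.*2.+1 by rewrite /= size_rcons size_s; lia.
have stepP j : j < l.*2 -> incidence H (node j) (node j.+1).
  move=> lt_j; have /(pathP (inl v))/(_ j) := path_s.
  by apply; rewrite size_rcons size_s; lia.
have parity j : j <= l.*2 -> is_edge (node j) = odd j.
  elim: j => [|j IHj] // le_j.
  by rewrite (incidence_alternates (stepP j le_j)) IHj //; lia.
have node_inj i j : i < l.*2 -> j < l.*2 -> node i = node j -> i = j.
  have nodeE a : a < l.*2 -> node a = nth (inl v) (inl v :: s) a.
    case: a => [|a] lt_a //=; rewrite /node /= nth_rcons ifT //.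
    by rewrite size_s; lia.
  move=> lt_i lt_j; rewrite !nodeE // => /eqP.
  by rewrite nth_uniq //= ?size_s; [move/eqP | lia | lia].
have node_last : node l.*2 = inl v.
  by case: l l_gt2 size_s {size_t stepP parity node_inj} => // l _ size_s;
     rewrite /node /= nth_rcons size_s /= ltnn eqxx.
pose vtx (p : V + {set V}) := if p is inl u then u else v : V.
pose edg (p : V + {set V}) := if p is inr f then f else set0 : {set V}.
pose e (i : 'I_l) := edg (node i.*2.+1).
pose w (i : 'I_l) := vtx (node i.*2).
have nodeV i : i < l -> node i.*2 = inl (vtx (node i.*2)).
  move=> lt_i; have := parity i.*2; rewrite odd_double.
  by case: (node _) => //= f; move/(_ ltac:(lia)).
have nodeE i : i < l -> node i.*2.+1 = inr (edg (node i.*2.+1)).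
  move=> lt_i; have := parity i.*2.+1; rewrite /= odd_double.
  by case: (node _) => //= f; move/(_ ltac:(lia)).
have step1 (i : 'I_l) : (e i \in H) && (w i \in e i).
  have lt_i := ltn_ord i; have := stepP i.*2 ltac:(lia).
  by rewrite nodeV // nodeE.
have step2 (i : 'I_l) : w (ordS i) \in e i.
  have lt_i := ltn_ord i; have := stepP i.*2.+1 ltac:(lia).
  rewrite nodeE // /w /=; have [lt_i1|ge_i1] := ltnP i.+1 l.
    by rewrite modn_small // -doubleS nodeV //= => /andP[].
  have -> : i.+1 = l by lia.
  have -> : i.*2.+2 = l.*2 by lia.
  by rewrite modnn node_last /= => /andP[].
exists [set e i | i : 'I_l]; split.
  by apply/subsetP=> f /imsetP[i _ ->]; have /andP[] := step1 i.
split=> //; exists e, w; split=> //.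
- move=> i j eq_ij; apply/val_inj.
  suff : i.*2.+1 = j.*2.+1 by move=> /= ; lia.
  have [lt_i lt_j] := (ltn_ord i, ltn_ord j).
  by apply: node_inj; [lia | lia | rewrite nodeE // [RHS]nodeE //; congr inr].
- move=> i j eq_ij; apply/val_inj.
  suff : i.*2 = j.*2 by move=> /= ; lia.
  have [lt_i lt_j] := (ltn_ord i, ltn_ord j).
  by apply: node_inj; [lia | lia | rewrite nodeV // [RHS]nodeV //; congr inl].
by move=> i; have /andP[_ ->] := step1 i; rewrite step2.
Qed.

Lemma contains_berge_cycle_sub (V : finType) (K H : {set {set V}}) l :
  K \subset H -> contains_berge_cycle K l -> contains_berge_cycle H l.
Proof. by move=> sKH [F [sFK cycF]]; exists F; rewrite (subset_trans sFK). Qed.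

(** Cutting a path at its first node in S, then removing its loops. *)
Lemma first_hit (T : eqType) (g : rel T) (S : pred T) (u : T) (p : seq T) :
  path g u p -> S (last u p) ->
  exists q, [/\ path g u q, uniq (u :: q), S (last u q)
              & {in u :: q, forall z, S z -> z = last u q}].
Proof.
suff: path g u p -> S (last u p) -> exists q, [/\ path g u q, S (last u q)
              & {in u :: q, forall z, S z -> z = last u q}].
  move=> hit gp /(hit gp)[q [gq Sq firstq]]; exists (shorten u q).
  move: Sq firstq; case/shortenP: gq => q' gq' uq' sq' Sq firstq; split=> //.
  move=> z; rewrite inE => /orP[/eqP->|/sq' zq].
    by apply: firstq; rewrite mem_head.
  by apply: firstq; rewrite inE zq orbT.
elim: p u => [|v p IHp] u /=.
  by move=> _ Su; exists [::]; split=> // z; rewrite inE => /eqP.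
move=> /andP[uv gp] /(IHp v gp)[q [gq Sq firstq]].
have [Su|nSu] := boolP (S u).
  by exists [::]; split=> // z; rewrite inE => /eqP.
exists (v :: q); split; rewrite /= ?uv // => z; rewrite inE => /orP[/eqP->|].
  by rewrite (negPf nSu).
exact: firstq.
Qed.

Lemma card_vertex_nodes (V : finType) (U : {set V + {set V}}) :
  #|[set v | inl v \in U]| <= #|U|.
Proof.
have inl_inj : injective (inl : V -> V + {set V}) by move=> u v [].
rewrite -(card_imset _ inl_inj); apply/subset_leq_card/subsetP=> q /imsetP[v].
by rewrite inE => vU ->.
Qed.

Lemma card_edge_nodes (V : finType) (U : {set V + {set V}}) :
  #|[set e | inr e \in U]| <= #|U|.
Proof.
have inr_inj : injective (inr : {set V} -> V + {set V}) by move=> u v [].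
rewrite -(card_imset _ inr_inj); apply/subset_leq_card/subsetP=> q /imsetP[e].
by rewrite inE => eU ->.
Qed.

Lemma card_setU2_leq (T : finType) (x y : T) (A : {set T}) :
  #|x |: (y |: A)| <= #|A|.+2.
Proof.
by rewrite cardsU1 -add1n leq_add ?leq_b1 // cardsU1 -add1n leq_add ?leq_b1.
Qed.

Lemma node_eq (V : finType) :
  (forall u v : V, (inl u == inl v :> V + {set V}) = (u == v)) *
  (forall e f : {set V}, (inr e == inr f :> V + {set V}) = (e == f)) *
  (forall (v : V) (e : {set V}), (inl v == inr e :> V + {set V}) = false) *
  (forall (v : V) (e : {set V}), (inr e == inl v :> V + {set V}) = false).
Proof.
by split; [split; [split|]|] => u v //; apply/eqP/eqP => [[]|->].
Qed.

(** * Dense stars *)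

Lemma leq_exp_base m n k : m <= n -> m ^ k <= n ^ k.
Proof. by move=> le_mn; elim: k => // k IHk; rewrite !expnS leq_mul. Qed.

Lemma leq_bin_exp n k : 'C(n, k) <= n ^ k.
Proof.
elim: n k => [|n IHn] [|k] //.
rewrite binS expnS mulSn addnC; apply: leq_add.
  by apply: leq_trans (IHn k) _; apply: leq_exp_base.
apply: leq_trans (IHn k.+1) _; rewrite expnS leq_mul2l.
by rewrite leq_exp_base ?orbT.
Qed.

(** Such an edge is determined by the r - 2 vertices it has in U besides z and
v. *)
Lemma card_edges_within (V : finType) (r : nat) (S : {set {set V}})
    (U : {set V}) z v :
  uniform r S -> z != v ->
  #|[set e in S | [&& z \in e, v \in e & e \subset z |: U]]| <= #|U| ^ (r - 2).
Proof.
move=> unifS neq_zv; apply: leq_trans _ (leq_bin_exp _ _).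
rewrite -cards_draws; set X := [set e in S | _].
have XP e : e \in X -> [/\ e \in S, z \in e, v \in e & e \subset z |: U].
  by rewrite inE => /and4P[].
have inj_X : {in X &, injective (fun e : {set V} => e :\ z :\ v)}.
  move=> e f /XP[_ ze ve _] /XP[_ zf vf _] /(congr1 (fun A => z |: (v |: A))).
  by rewrite !setD1K // !inE ?ve ?vf eq_sym neq_zv.
rewrite -(card_in_imset inj_X); apply/subset_leq_card/subsetP=> A.
case/imsetP=> e /XP[/unifS card_e ze ve /subsetP sub_e] ->{A}.
rewrite inE; apply/andP; split.
  apply/subsetP=> u; rewrite !inE => /and3P[_ nuz /sub_e].
  by rewrite !inE (negPf nuz).
have := cardsD1 z e; have := cardsD1 v (e :\ z).
rewrite !inE ze ve eq_sym neq_zv card_e; lia.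
Qed.

(** An edge through v is useless if it is in U already or if all its vertices
other than z are in U; there are at most b + b ^ (r - 2) <= 2 * b ^ (r - 2)
such edges. *)
Lemma star_step (V : finType) (r : nat) (S : {set {set V}}) z v
    (U : {set V + {set V}}) (b : nat) :
  2 < r -> uniform r S -> z != v -> inl z \in U -> #|U| <= b ->
  {in S, forall e : {set V}, z \in e} ->
  2 * b ^ (r - 2) < #|[set e in S | v \in e]| ->
  exists e, exists2 u,
    e \in S & [/\ v \in e, u \in e, inr e \notin U & inl u \notin U].
Proof.
move=> r_gt2 unifS neq_zv zU le_b star_z deg_v.
pose UV := [set u | inl u \in U]; pose UE := [set e | inr e \in U].
have le_UV : #|UV| <= b := leq_trans (card_vertex_nodes U) le_b.
have le_UE : #|UE| <= b ^ (r - 2).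
  apply: leq_trans (leq_trans (card_edge_nodes U) le_b) _.
  have -> : r - 2 = (r - 3).+1 by lia.
  have U_gt0 : 0 < #|U| by apply/card_gt0P; exists (inl z).
  by rewrite expnS leq_pmulr // expn_gt0 (leq_trans U_gt0).
have le_in := leq_trans (card_edges_within UV unifS neq_zv)
  (leq_exp_base (r - 2) le_UV).
case: (set_0Vmem ([set e in S | v \in e] :\: UE :\: [set e in S |
    [&& z \in e, v \in e & e \subset z |: UV]])) => [eq0|[e]].
  move/eqP: eq0; rewrite setD_eq0 => /subset_leq_card le_out.
  move: deg_v; rewrite ltnNge mul2n -addnn -(cardsID UE) leq_add //.
    exact: leq_trans (subset_leq_card (subsetIr _ _)) le_UE.
  exact: leq_trans le_out le_in.
rewrite !inE => /and4P[nsub neU eS ve].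
move: nsub; rewrite eS ve star_z //= => /subsetPn[u ue].
rewrite !inE negb_or => /andP[_ nuU].
by exists e, u.
Qed.

Lemma star_walk (V : finType) (r : nat) (S : {set {set V}}) z (b n : nat) v
    (U : {set V + {set V}}) :
  2 < r -> uniform r S -> {in S, forall e : {set V}, z \in e} ->
  (forall e u, e \in S -> u \in e -> u != z ->
     2 * b ^ (r - 2) < #|[set f in S | u \in f]|) ->
  v != z -> v \in cover S -> inl z \in U -> #|U| + n.*2 <= b ->
  exists p u, [/\ [/\ size p = n.*2, path (incidence S) (inl v) p
                    & last (inl v) p = inl u],
                  uniq p, {in p, forall q, q \notin U}, u != z
                & u \in cover S].
Proof.
move=> r_gt2 unifS star_z core.
elim: n v U => [|n IHn] v U nvz vS zU le_b; first by exists [::], v.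
have [e0 e0S ve0] := bigcupP vS.
have [||e [u eS [ve ue neU nuU]]] :=
    star_step r_gt2 unifS _ zU _ star_z (core _ _ e0S ve0 nvz).
- by rewrite eq_sym.
- lia.
have nuz : u != z by apply: contraNneq nuU => ->.
have uS : u \in cover S by apply/bigcupP; exists e.
have [||p [w [[size_p path_p last_p] uniq_p avoid_p nwz wS]]] :=
    IHn u (inr e |: (inl u |: U)) nuz uS.
- by rewrite !inE zU !orbT.
- apply: leq_trans le_b; rewrite doubleS 2!addnS -2!addSn leq_add2r.
  exact: card_setU2_leq.
exists (inr e :: inl u :: p), w; split=> //.
- by split; rewrite /= ?size_p ?eS ?ve ?ue.
- rewrite /= uniq_p !inE /= andbT.
  by apply/andP; split; apply/negP => /avoid_p; rewrite !inE eqxx ?orbT.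
- move=> q; rewrite !inE => /or3P[/eqP->//|/eqP->//|/avoid_p].
  by rewrite !inE !negb_or => /and3P[].
Qed.

(** The walk starts at some u in an edge f containing z, with f kept aside to
close the cycle; since every edge contains z, the walk can be brought back to z
after any number of steps. *)
Lemma dense_star_cycles (V : finType) (r : nat) (S : {set {set V}}) z
    (k l : nat) :
  2 < r -> uniform r S -> S != set0 -> {in S, forall e : {set V}, z \in e} ->
  (forall e u, e \in S -> u \in e -> u != z ->
     2 * (5 * k) ^ (r - 2) < #|[set f in S | u \in f]|) ->
  2 < l < k + 3 -> contains_berge_cycle S l.
Proof.
move=> r_gt2 unifS /set0Pn[f fS] star_z core /andP[l_gt2 lt_l].
have [u uf nuz] : exists2 u, u \in f & u != z.
  have [x] : exists x, x \in f :\ z.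
    apply/card_gt0P; have := cardsD1 z f; rewrite star_z // unifS //; lia.
  by rewrite !inE => /andP[nxz xf]; exists x.
have uS : u \in cover S by apply/bigcupP; exists f.
pose U : {set V + {set V}} := inl u |: (inr f |: [set inl z]).
have cardU : #|U| <= 3 by rewrite (leq_trans (card_setU2_leq _ _ _)) ?cards1.
have zU : inl z \in U by rewrite !inE eqxx !orbT.
have [|p [w [[size_p path_p last_p] uniq_p avoid_p nwz wS]]] :=
  @star_walk V r S z (5 * k) (l - 2) u U r_gt2 unifS star_z core nuz uS zU.
  by apply: leq_trans (leq_add cardU (leqnn _)) _; move: l_gt2 lt_l; clear; lia.
pose U' : {set V + {set V}} := U :|: [set q in p].
have cardU' : #|U'| <= 5 * k.
  have le_p : #|[set q in p]| <= size p by rewrite cardsE card_size.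
  apply: leq_trans (leq_card_setU _ _) _.
  by apply: leq_trans (leq_add cardU le_p) _; rewrite size_p;
     move: l_gt2 lt_l; clear; lia.
have [e0 e0S we0] := bigcupP wS.
have zU' : inl z \in U' by rewrite inE zU.
have [|e [x eS [we _ neU' _]]] :=
  star_step r_gt2 unifS _ zU' cardU' star_z (core _ _ e0S we0 nwz).
  by rewrite eq_sym.
(* The cycle is z, f, u, then the walk to w, then e back to z. *)
apply: (@berge_of_incidence_cycle V S l z
  (inr f :: inl u :: rcons p (inr e))) => //.
- by rewrite /= size_rcons size_p; move: l_gt2; clear; lia.
- have nU q : q \in U -> q \notin p by apply: contraL => /avoid_p.
  have neUp q : q \in U' -> inr e != q by apply: contraTneq => <-.
  have nep : inr e \notin p by apply/negP=> ep; rewrite !inE ep orbT in neU'.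
  have U'1 q : q \in U -> q \in U' by move=> qU; rewrite inE qU.
  have uU : inl u \in U by rewrite !inE eqxx.
  have fU : inr f \in U by rewrite !inE eqxx orbT.
  rewrite /= !rcons_uniq !inE !mem_rcons !inE !negb_or uniq_p nep !nU //.
  rewrite ![_ == inr e]eq_sym !neUp ?U'1 //= !andbT.
  by apply: contraNneq nuz => -[->].
rewrite /cycle /= fS star_z // uf /= !rcons_path path_p last_rcons last_p /=.
by rewrite eS we star_z.
Qed.

(** * Connected dense subhypergraphs *)

(** If S is not connected then it splits into two parts covering disjoint sets
of vertices, and one of them is at least as dense as S. *)
Lemma dense_connected (V : finType) (M : nat) (S : {set {set V}}) :
  M * #|cover S| < #|S| ->
  exists2 K : {set {set V}}, K \subset S & M * #|cover K| < #|K| /\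
    {in cover K &, forall u v, connect (incidence K) (inl u) (inl v)}.
Proof.
have [s] := ubnP #|S|; elim: s S => // s IHs S lt_S_s dense_S.
have [/forall_inP conn|] := boolP [forall u in cover S, forall v in cover S,
    connect (incidence S) (inl u) (inl v)].
  by exists S => //; split=> // u v uS vS; have /forall_inP := conn u uS; apply.
rewrite negb_forall_in => /exists_inP[u /bigcupP[e eS ue]].
rewrite negb_forall_in => /exists_inP[v /bigcupP[f fS vf] not_uv].
pose X := [set g in S | connect (incidence S) (inl u) (inr g)].
have sXS : X \subset S by apply/subsetP=> g; rewrite inE => /andP[].
have eX : e \in X by rewrite inE eS connect1 //= eS ue.
have nfX : f \notin X.
  rewrite inE fS; apply: contra not_uv => /= uf.
  by apply: connect_trans uf (connect1 _); rewrite /= fS vf.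
have cardS : #|S| = #|X| + #|S :\: X| by rewrite -(cardsID X S) (setIidPr sXS).
have card_cover : #|cover X| + #|cover (S :\: X)| <= #|cover S|.
  rewrite -cardsUI [X in _ + X <= _](_ : _ = 0) ?addn0.
    apply/subset_leq_card; rewrite subUset; apply/andP; split.
      by apply/bigcupsP=> g gX; apply: bigcup_sup (subsetP sXS _ gX).
    by apply/bigcupsP=> g /setDP[gS _]; apply: bigcup_sup gS.
  apply: eq_card0 => w; rewrite inE; apply/andP => -[/bigcupP[g]].
  rewrite inE => /andP[gS ug] wg /bigcupP[h /setDP[hS nhX] wh].
  move: nhX; rewrite inE hS /=; apply/negP/negPn.
  apply: connect_trans ug _; apply: (@connect_trans _ _ (inl w)).
    by rewrite connect1 //= gS wg.
  by rewrite connect1 //= hS wh.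
have sub_case (Y : {set {set V}}) : Y \subset S -> #|Y| < s ->
    M * #|cover Y| < #|Y| -> exists2 K : {set {set V}}, K \subset S &
    M * #|cover K| < #|K| /\
    {in cover K &, forall u v, connect (incidence K) (inl u) (inl v)}.
  move=> sYS lt_Y dense_Y; have [K sKY PK] := IHs Y lt_Y dense_Y.
  by exists K => //; apply: subset_trans sYS.
have X_gt0 : 0 < #|X| by apply/card_gt0P; exists e.
have X'_gt0 : 0 < #|S :\: X| by apply/card_gt0P; exists f; rewrite inE nfX.
have [dense_X|sparse_X] := ltnP (M * #|cover X|) #|X|.
  by apply: sub_case dense_X; lia.
apply: (sub_case (S :\: X)); [exact: subsetDl | lia | nia].
Qed.

(** * Breadth-first levels *)

Lemma bfs_levels (N : finType) (g : rel N) (root : N) :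
  exists d : N -> nat,
   [/\ d root = 0,
       forall u, connect g root u -> u != root ->
         exists p, [/\ g p u, connect g root p & d u = (d p).+1]
     & forall u v, connect g root u -> g u v -> d v <= (d u).+1].
Proof.
pose walk u n := exists p, [/\ path g root p, last root p = u & size p = n].
have [d dP] : exists d : N -> nat, forall u, connect g root u ->
    walk u (d u) /\ forall n, walk u n -> d u <= n.
  apply: (@fin_all_exists N (fun=> nat) (fun u m => connect g root u ->
    walk u m /\ forall n, walk u n -> m <= n)) => u.
  have [root_u|] := boolP (connect g root u); last by exists 0.
  have walkP n : reflect (walk u n)
      [exists p : n.-tuple N, path g root p && (last root p == u)].
    apply: (iffP existsP) => [[p /andP[gp /eqP up]]|[p [gp up sp]]].
      by exists p; rewrite size_tuple.
    by exists (Tuple (introT eqP sp)); rewrite gp up eqxx.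
  have ex : exists n,
      [exists p : n.-tuple N, path g root p && (last root p == u)].
    by have /connectP[p gp up] := root_u; exists (size p);
       apply/walkP; exists p.
  case: (ex_minnP ex) => m /walkP um min_m.
  by exists m => _; split=> // n /walkP; apply: min_m.
exists d; split.
- have [_ /(_ 0)] := dP _ (connect0 g root).
  by case: (d root) => // n /(_ ltac:(by exists [::])).
- move=> u root_u; have [[p [gp up sp]] min_u] := dP u root_u.
  case/lastP: p gp up sp => [|p x]; first by move=> _ /= ->; rewrite eqxx.
  rewrite rcons_path last_rcons size_rcons => /andP[gp px] xu sp _.
  have root_p : connect g root (last root p) by apply/connectP; exists p.
  exists (last root p); split=> //; first by rewrite -xu.
  have [[q [gq uq sq]] min_p] := dP _ root_p.
  apply/eqP; rewrite eqn_leq -{2}sp ltnS min_p ?andbT; last by exists p.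
  apply: min_u; exists (rcons q u); split; last by rewrite size_rcons sq.
    by rewrite rcons_path gq uq -xu.
  by rewrite last_rcons.
move=> u v root_u uv; have [[p [gp up sp]] _] := dP u root_u.
have root_v : connect g root v := connect_trans root_u (connect1 uv).
have [_ ] := dP v root_v; apply; exists (rcons p v).
by rewrite rcons_path last_rcons size_rcons gp up uv sp.
Qed.

(** Replace Z by the set of parents of its elements, one level below, until all
parents coincide: then any one element can be separated from the others, and
the partition is pulled back along the parent maps, each of which lengthens the
connecting paths by 2. *)
Lemma level_fork (N : finType) (g : rel N) (root : N) (d : N -> nat) (i : nat)
    (Z : {set N}) :
  symmetric g -> d root = 0 ->
  (forall u, connect g root u -> u != root ->
     exists p, [/\ g p u, connect g root p & d u = (d p).+1]) ->
  {in Z, forall z, connect g root z /\ d z = i} -> 1 < #|Z| ->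
  exists (A B : {set N}) (c : nat),
    [/\ A != set0, B != set0, A :|: B = Z, [disjoint A & B]
      & {in A & B, forall a b, exists q,
          [/\ size q = c.*2.+1, path g a (rcons q b), uniq q
            & {in q, forall z, d z < i}]}].
Proof.
move=> g_sym d_root parent; elim: i Z => [|i IHi] Z levelZ.
  suff /subset_leq_card : Z \subset [set root] by rewrite cards1; lia.
  apply/subsetP=> z /levelZ[root_z dz]; rewrite inE.
  by apply/negPn/negP => /(parent z root_z)[p [_ _]]; rewrite dz.
move=> Z_gt1.
have [p pP] : exists p : N -> N, forall z, z \in Z ->
    [/\ g (p z) z, connect g root (p z) & d (p z) = i].
  apply: (@fin_all_exists N (fun=> N) (fun z y => z \in Z ->
    [/\ g y z, connect g root y & d y = i])) => z.
  have [zZ|] := boolP (z \in Z); last by exists z.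
  have [root_z dz] := levelZ z zZ.
  have [|y [yz root_y dy]] := parent z root_z.
    by apply: contra_eq_neq dz => ->; rewrite d_root.
  by exists y => _; split=> //; lia.
have [le1|gt1] := leqP #|p @: Z| 1.
  have [z0 z0Z] : exists z0, z0 \in Z by apply/card_gt0P; lia.
  exists [set z0], (Z :\ z0), 0; split.
  - by apply/set0Pn; exists z0; rewrite inE.
  - by rewrite -card_gt0; have := cardsD1 z0 Z; rewrite z0Z; lia.
  - by rewrite setD1K.
  - by rewrite disjoints1 !inE eqxx.
  move=> a b; rewrite !inE => /eqP-> /andP[_ bZ].
  have [z0p _ dp] := pP z0 z0Z; have [bp _ _] := pP b bZ.
  have pzb : p z0 = p b.
    by move/card_le1_eqP: le1; apply; apply: imset_f.
  exists [:: p z0]; split=> //=; first by rewrite g_sym z0p pzb bp.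
  by move=> z; rewrite inE => /eqP->; rewrite dp.
have [|A [B [c [A0 B0 AB disAB link]]]] := IHi (p @: Z) _ gt1.
  by move=> y /imsetP[z zZ ->]; have [] := pP z zZ.
exists [set z in Z | p z \in A], [set z in Z | p z \in B], c.+1; split.
- have [y yA] := set0Pn _ A0; have : y \in p @: Z by rewrite -AB inE yA.
  by case/imsetP=> z zZ yz; apply/set0Pn; exists z; rewrite inE zZ -yz.
- have [y yB] := set0Pn _ B0; have : y \in p @: Z by rewrite -AB inE yB orbT.
  by case/imsetP=> z zZ yz; apply/set0Pn; exists z; rewrite inE zZ -yz.
- apply/setP=> z; rewrite !inE; have [zZ|] //= := boolP (z \in Z).
  by have := imset_f p zZ; rewrite -AB inE.
- rewrite -setI_eq0; apply/eqP/setP=> z; rewrite !inE.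
  apply/negP => /andP[/andP[_ pA] /andP[_ pB]].
  by have := disjointFr disAB pA; rewrite pB.
move=> a b; rewrite !inE => /andP[aZ pa] /andP[bZ pb].
have [ga _ da] := pP a aZ; have [gb _ db] := pP b bZ.
have [q [size_q path_q uniq_q level_q]] := link _ _ pa pb.
exists (p a :: rcons q (p b)); split.
- by rewrite /= size_rcons size_q doubleS.
- by rewrite /= g_sym ga rcons_path path_q last_rcons gb.
- rewrite /= rcons_uniq uniq_q mem_rcons inE negb_or.
  have nq z : d z = i -> z \notin q.
    by move=> dz; apply/negP => /level_q; rewrite dz ltnn.
  rewrite !nq // !andbT; apply/eqP => eq_p.
  by have := disjointFr disAB pa; rewrite eq_p pb.
move=> z; rewrite inE mem_rcons inE => /or3P[/eqP->|/eqP->|/level_q].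
- by rewrite da.
- by rewrite db.
- by lia.
Qed.

(** * Walks in a dense system of triples *)

(** Each edge e of T is seen as a triple of its vertices in which the pair (a
e, x e) determines e; so T is also a bipartite graph between the values of a
and those of x, with an injective choice of a hyperedge over each of its edges.
*)
Record triple_system (V : finType) (D : nat) (T : {set {set V}})
    (a x y : {set V} -> V) : Prop := TripleSystem {
  triple_mem : forall e, e \in T -> [/\ a e \in e, x e \in e & y e \in e];
  triple_neq : forall e, e \in T -> [/\ a e != x e, a e != y e & x e != y e];
  triple_inj : forall e f, e \in T -> f \in T ->
    a e = a f -> x e = x f -> e = f;
  triple_degree : forall e, e \in T ->
    [/\ D < #|[set f in T | a f == a e]|, D < #|[set f in T | x f == x e]|
      & D < #|[set f in T | y f == y e]|]
}.

(** The two sides of the bipartite graph carried by a triple system. A vertex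
may be on both sides, so walks keep track of the role in which they visit it.
*)
Definition role (V : finType) (a x : {set V} -> V) (b : bool) :=
  if b then a else x.

Definition triple_node (V : finType) (T : {set {set V}}) (a x y : {set V} -> V)
    (q : V + {set V}) : bool :=
  match q with
  | inl v => [|| v \in a @: T, v \in x @: T | v \in y @: T]
  | inr e => e \in T
  end.

(** Every node of U blocks at most one of the more than D triples at u: an edge
blocks itself and a vertex v blocks the triple with other role v. *)
Lemma role_step (V : finType) D (T : {set {set V}}) a x y b u
    (U : {set V + {set V}}) :
  triple_system D T a x y -> u \in role a x b @: T -> #|U| <= D ->
  exists e, [/\ e \in T, role a x b e = u, inr e \notin U
              & inl (role a x (~~ b) e) \notin U].
Proof.
move=> sysT /imsetP[e0 e0T ue0] le_U.
pose Tu := [set f in T | role a x b f == u].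
have lt_D : D < #|Tu|.
  by have [] := triple_degree sysT e0T; rewrite /Tu ue0; case: (b).
pose node f : V + {set V} :=
  if inr f \in U then inr f else inl (role a x (~~ b) f).
have node_inj : {in Tu &, injective node}.
  move=> f h; rewrite !inE => /andP[fT /eqP fu] /andP[hT /eqP hu].
  rewrite /node; case: ifP => _; case: ifP => _ //; first by case.
  by case=> eq_r; apply: (triple_inj sysT) => //; case: (b) eq_r fu hu => /=;
     congruence.
have /subsetPn[_ /imsetP[f fTu ->]] : ~~ (node @: Tu \subset U).
  apply/negP => /subset_leq_card; rewrite card_in_imset // leqNgt.
  by rewrite (leq_ltn_trans le_U).
move: fTu; rewrite inE => /andP[fT /eqP fu].
by rewrite /node; case: ifPn => [->//|nfU nrU]; exists f.
Qed.

Lemma role_node (V : finType) (T : {set {set V}}) a x y b e :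
  e \in T -> triple_node T a x y (inl (role a x b e)).
Proof. by case: b => eT /=; rewrite imset_f ?orbT. Qed.

Lemma role_mem (V : finType) D (T : {set {set V}}) a x y b e :
  triple_system D T a x y -> e \in T -> role a x b e \in e.
Proof. by move=> sysT eT; case: b; case: (triple_mem sysT eT). Qed.

Lemma role_walk (V : finType) D (T : {set {set V}}) a x y n b u
    (U : {set V + {set V}}) :
  triple_system D T a x y -> u \in role a x b @: T -> #|U| + n.*2 <= D ->
  exists p v, [/\ [/\ size p = n.*2, path (incidence T) (inl u) p
                  & last (inl u) p = inl v],
                uniq p, {in p, forall q, q \notin U},
                {in p, forall q, triple_node T a x y q}
              & v \in role a x (b (+) odd n) @: T].
Proof.
move=> sysT; elim: n b u U => [|n IHn] b u U ub le_D.
  by exists [::], u; rewrite addbF; split.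
have [|e [eT eu neU nvU]] := role_step sysT ub (U := U).
  by apply: leq_trans le_D; rewrite leq_addr.
set v := role a x (~~ b) e in nvU.
have [||p [w [[size_p path_p last_p] uniq_p avoid_p node_p wb]]] :=
    IHn (~~ b) v (inr e |: (inl v |: U)).
- exact: imset_f.
- apply: leq_trans le_D; rewrite doubleS 2!addnS -2!addSn leq_add2r.
  exact: card_setU2_leq.
exists (inr e :: inl v :: p), w; split=> //.
- by split; rewrite /= ?size_p ?eT // -eu /v !(role_mem _ sysT).
- rewrite /= uniq_p !inE /= andbT.
  by apply/andP; split; apply/negP => /avoid_p; rewrite !inE eqxx ?orbT.
- move=> q; rewrite !inE => /or3P[/eqP->//|/eqP->//|/avoid_p].
  by rewrite !inE !negb_or => /and3P[].
- move=> q; rewrite !inE => /or3P[/eqP->//|/eqP->|/node_p//].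
  exact: role_node.
by rewrite /= addbN -addNb.
Qed.

Lemma fresh_triple (T : finType) (A : {set T}) (e f : T) :
  2 < #|A| -> exists2 h, h \in A & h != e /\ h != f.
Proof.
move=> A_gt2; have [h] : exists h, h \in A :\ e :\ f.
  by apply/card_gt0P; have := cardsD1 e A; have := cardsD1 f (A :\ e); lia.
by rewrite !inE => /and3P[hf he hA]; exists h.
Qed.

(** If w already has the role b, stand still. If it has only the other role,
two triples sharing their third vertex give a walk w, y, u of two steps where u
has the role b, whereas two steps of an alternating walk lead back to the role
of w. If w is only a third vertex, step to the vertex of role ~~ b in a triple
through w. The edge e0 and the vertex w itself are avoided. *)
Lemma parity_switch (V : finType) D (T : {set {set V}}) a x y w e0 (b : bool) :
  triple_system D T a x y -> 2 < D -> triple_node T a x y (inl w) ->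
  exists s p b' u, [/\ s <= 2, b' (+) odd s = b,
    [/\ size p = s.*2, path (incidence T) (inl w) p & last (inl w) p = inl u],
    [/\ uniq p, {in p, forall q, q \notin [set inl w; inr e0]}
      & {in p, forall q, triple_node T a x y q}]
    & u \in role a x b' @: T].
Proof.
move=> sysT D_gt2 w_node.
have [wb|nwb] := boolP (w \in role a x b @: T).
  by exists 0, [::], b, w; rewrite addbF; split.
have degree c e : e \in T -> 2 < #|[set f in T | role a x c f == role a x c e]|.
  by move=> /(triple_degree sysT)[]; case: c => /=; lia.
have degree_y e : e \in T -> 2 < #|[set f in T | y f == y e]|.
  by move=> /(triple_degree sysT)[]; lia.
have [wnb|nwnb] := boolP (w \in role a x (~~ b) @: T).
  have /imsetP[e1' e1'T w_e1'] := wnb.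
  have [e1] := fresh_triple e0 e0 (degree (~~ b) e1' e1'T).
  rewrite inE -w_e1' => /andP[e1T /eqP e1w] [ne10 _].
  have [e2] := fresh_triple e0 e1 (degree_y e1 e1T).
  rewrite inE => /andP[e2T /eqP y12] [ne20 ne21].
  have nr2w : role a x b e2 != w by apply: contraNneq nwb => <-; apply: imset_f.
  have nyw : y e1 != w.
    rewrite -e1w; have [_ nay nxy] := triple_neq sysT e1T.
    by case: (~~ b) => /=; rewrite eq_sym.
  have nyr : y e1 != role a x b e2.
    rewrite -y12; have [_ nay nxy] := triple_neq sysT e2T.
    by case: (b) => /=; rewrite eq_sym.
  have [_ _ ye1] := triple_mem sysT e1T; have [_ _ ye2] := triple_mem sysT e2T.
  exists 2, [:: inr e1; inl (y e1); inr e2; inl (role a x b e2)], b,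
    (role a x b e2); split=> //.
  - by rewrite addbF.
  - split=> //=; rewrite e1T e2T ye1 -{1}e1w -{1}y12 ye2.
    by rewrite !(role_mem _ sysT).
  - split.
    + by rewrite /= !inE !node_eq /= [e1 == e2]eq_sym (negPf ne21) nyr.
    + by move=> q; rewrite !inE => /or4P[]/eqP->; rewrite !node_eq ?orbF.
    move=> q; rewrite !inE => /or4P[]/eqP->//.
      by rewrite /= (imset_f y) ?orbT.
    exact: role_node.
  exact: imset_f.
have /imsetP[e1' e1'T w_e1'] : w \in y @: T.
  by case: (b) nwb nwnb w_node => /= /negPf-> /negPf->.
have [e1] := fresh_triple e0 e0 (degree_y e1' e1'T).
rewrite inE -w_e1' => /andP[e1T /eqP e1w] [ne10 _].
have [_ _ ye1] := triple_mem sysT e1T.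
have nrw : role a x (~~ b) e1 != w.
  by apply: contraNneq nwnb => <-; apply: imset_f.
exists 1, [:: inr e1; inl (role a x (~~ b) e1)], (~~ b), (role a x (~~ b) e1).
split=> //.
- by case: (b).
- by split=> //=; rewrite e1T -{1}e1w ye1 (role_mem _ sysT).
- split=> //.
  + by move=> q; rewrite !inE => /orP[]/eqP->; rewrite !node_eq ?orbF.
  move=> q; rewrite !inE => /orP[]/eqP->//.
  exact: role_node.
exact: imset_f.
Qed.

(** The role in which the alternating walk starts is chosen so that it ends
among the marks after n steps in total, the possible detour included. *)
Lemma triple_walks (V : finType) D (T : {set {set V}}) a x y w e0 n :
  triple_system D T a x y -> 1 < n -> n.*2 + 6 <= D ->
  triple_node T a x y (inl w) ->
  exists p v, [/\ [/\ size p = n.*2, path (incidence T) (inl w) p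
                    & last (inl w) p = inl v],
                  uniq p, {in p, forall q, q \notin [set inl w; inr e0]},
                  {in p, forall q, triple_node T a x y q}
                & v \in a @: T].
Proof.
move=> sysT n_gt1 le_D w_node.
have [|s [p [b [u [s_le2 bs [size_p path_p last_p]
    [uniq_p avoid_p node_p] ub]]]]] :=
  parity_switch e0 (~~ odd n) sysT _ w_node.
  by lia.
pose U := [set inl w; inr e0] :|: [set q in p] : {set V + {set V}}.
have le_U : #|U| <= 2 + s.*2.
  have le_p : #|[set q in p]| <= s.*2 by rewrite cardsE -size_p card_size.
  apply: leq_trans (leq_card_setU _ _) (leq_add _ le_p).
  by rewrite cardsU1 cards1 addn1 ltnS leq_b1.
have [|p' [v [[size_p' path_p' last_p'] uniq_p' avoid_p' node_p' vb]]] :=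
    role_walk (n := n - s) (U := U) sysT ub.
  by apply: leq_trans (leq_add le_U (leqnn _)) _; lia.
exists (p ++ p'), v; split.
- rewrite size_cat size_p size_p' cat_path last_cat path_p last_p path_p'.
  by split=> //; lia.
- rewrite cat_uniq uniq_p uniq_p' andbT; apply/hasPn => q /avoid_p'.
  by apply: contra => qp; rewrite !inE qp orbT.
- move=> q; rewrite mem_cat => /orP[/avoid_p//|/avoid_p'].
  by apply: contra => qU; rewrite inE qU.
- by move=> q; rewrite mem_cat => /orP[/node_p|/node_p'].
suff br : b (+) odd (n - s) = true by rewrite br in vb.
by rewrite oddB 1?(leq_trans s_le2) // addbA addbAC bs; case: (odd n).
Qed.

(** * From marked edges to triples *)

(** Peeling is used twice. With the nodes (a e, v), for v in e other than a e,
a core contains a dense star at a mark, and otherwise there is a large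
subfamily with distinct pairs (a e, x e). With the three slots of a triple as
nodes, there are too few nodes for this subfamily to be peeled off completely,
so it has a core. *)
Lemma triples_of_marked_edges (V : finType) (r k D : nat) (S : {set {set V}})
    (a : {set V} -> V) :
  2 < r -> uniform r S -> {in S, forall e : {set V}, a e \in e} ->
  2 * (5 * k) ^ (r - 2) * (D * (3 * #|cover S|)) < #|S| ->
  (forall l, 2 < l < k + 3 -> contains_berge_cycle S l) \/
  (exists (T : {set {set V}}) (x y : {set V} -> V),
     [/\ T \subset S, T != set0 & triple_system D T a x y]).
Proof.
move=> r_gt2 unifS aP dense_S; set m := 2 * _ in dense_S.
have [e0 _] : exists e0, e0 \in S.
  by apply/card_gt0P; apply: leq_ltn_trans dense_S.
pose pairs (e : {set V}) := [set (a e, v) | v in e :\ a e].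
have pairsP e z v : (z, v) \in pairs e = [&& z == a e, v != z & v \in e].
  apply/imsetP/and3P => [[u]|[/eqP-> nv ve]].
    by rewrite !inE => /andP[nu ue] [-> ->].
  by exists v; rewrite ?inE ?nv.
have [[S' sS' [S'_neq0 core]]|[F [g [sF g_inj g_in le_S]]]] :=
    peel pairs m S (a e0, a e0).
  left=> l lt_l; have [e1 e1S'] := set0Pn _ S'_neq0.
  pose S1 := [set e in S' | a e == a e1].
  have sS1 : S1 \subset S.
    by apply/subsetP=> e; rewrite inE => /andP[/(subsetP sS')].
  apply: (contains_berge_cycle_sub sS1).
  apply: (@dense_star_cycles V r S1 (a e1) k) => //.
  - by move=> e /(subsetP sS1)/unifS.
  - by apply/set0Pn; exists e1; rewrite inE e1S' eqxx.
  - by move=> e /[dup] /(subsetP sS1)/aP ae; rewrite inE => /andP[_ /eqP<-].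
  move=> e u; rewrite inE => /andP[eS' /eqP ae] ue nu.
  have /(core e _ eS') lt_m : (a e1, u) \in pairs e.
    by rewrite pairsP ae eqxx nu.
  apply: leq_trans lt_m _; apply/subset_leq_card/subsetP=> f.
  by rewrite !inE pairsP eq_sym => /andP[-> /and3P[-> _ ->]].
right; pose x e := (g e).2.
have xP e : e \in F -> [/\ g e = (a e, x e), x e != a e & x e \in e].
  move=> /g_in; rewrite /x; case: (g e) => z v; rewrite pairsP /=.
  by case/and3P=> /eqP-> nv ve.
pose y e := odflt (x e) [pick v in e :\ a e :\ x e].
have yP e : e \in F -> [/\ y e != a e, y e != x e & y e \in e].
  move=> eF; have [_ nx xe] := xP e eF; have eS := subsetP sF e eF.
  rewrite /y; case: pickP => [v|/eq_card0 /=].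
    by rewrite !inE => /and3P[nvx nva ve].
  have := cardsD1 (a e) e; have := cardsD1 (x e) (e :\ a e).
  rewrite !inE nx xe (aP e eS) (unifS e eS) /= => -> + empty.
  by rewrite empty; lia.
pose slots e := [set (None, a e); (Some true, x e); (Some false, y e)].
have [[T sT [T_neq0 core]]|[F2 [g2 [sF2 g2_inj g2_in le_F]]]] :=
    peel slots D F (None, a e0).
  have TF := subsetP sT.
  exists T, x, y; split=> //; first exact: subset_trans sF.
  split.
  - move=> e /TF eF; have [_ _ xe] := xP e eF; have [_ _ ye] := yP e eF.
    by rewrite aP // (subsetP sF).
  - move=> e /TF eF; have [_ nx _] := xP e eF; have [nya nyx _] := yP e eF.
    by rewrite eq_sym nx eq_sym nya eq_sym nyx.
  - move=> e f /TF eF /TF fF eq_a eq_x; apply: g_inj => //.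
    have [-> _ _] := xP e eF; have [-> _ _] := xP f fF.
    by rewrite eq_a eq_x.
  move=> e eT; split.
  - have /(core e _ eT) : (None, a e) \in slots e by rewrite !inE eqxx.
    move/leq_trans; apply; apply/subset_leq_card/subsetP=> f.
    by rewrite !inE !xpair_eqE /= !orbF eq_sym.
  - have /(core e _ eT) : (Some true, x e) \in slots e.
      by rewrite !inE eqxx orbT.
    move/leq_trans; apply; apply/subset_leq_card/subsetP=> f.
    by rewrite !inE !xpair_eqE /= !orbF eq_sym.
  have /(core e _ eT) : (Some false, y e) \in slots e.
    by rewrite !inE eqxx orbT.
  move/leq_trans; apply; apply/subset_leq_card/subsetP=> f.
  by rewrite !inE !xpair_eqE /= eq_sym.
have le_F2 : #|F2| <= 3 * #|cover S|.
  have -> : 3 * #|cover S| = #|setX [set: option bool] (cover S)|.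
    by rewrite cardsX cardsT card_option card_bool.
  rewrite -(card_in_imset g2_inj); apply/subset_leq_card/subsetP=> q.
  case/imsetP=> e eF2 ->; have eF := subsetP sF2 e eF2.
  have [_ _ xe] := xP e eF; have [_ _ ye] := yP e eF.
  have eS := subsetP sF e eF.
  have sub_e : e \subset cover S := bigcup_sup e eS.
  have := g2_in e eF2; rewrite !inE => /orP[/orP[]|] /eqP-> /=;
    apply: (subsetP sub_e) => //; exact: aP.
move: dense_S; rewrite ltnNge (leq_trans le_S) // leq_mul2l.
by rewrite (leq_trans le_F) ?orbT // leq_mul2l le_F2 orbT.
Qed.

(** * Closing the cycles *)

Definition node_of (V : finType) (K : {set {set V}}) (q : V + {set V}) : bool :=
  match q with inl v => v \in cover K | inr e => e \in K end.

Lemma incidence_path_nodes (V : finType) (K : {set {set V}}) q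
    (p : seq (V + {set V})) :
  path (incidence K) q p -> {in p, forall z, node_of K z}.
Proof.
elim: p q => [|z p IHp] q //= /andP[qz path_p] t; rewrite inE.
case/orP=> [/eqP->|]; last exact: IHp path_p t.
case: q z qz {path_p t} => [v|e] [u|f] //= /andP[]; first by [].
by move=> eK ue; apply/bigcupP; exists e.
Qed.

(** The path of K from b to the triple system can meet it for the first time at
a vertex w, or at an edge e0 of T through a vertex of e0 outside the triple; in
the latter case it is continued to the mark of e0, and the walk from there must
avoid e0. *)
Lemma cycles_from_triples (V : finType) (H K T : {set {set V}})
    (a x y : {set V} -> V) (D k c : nat) (b : V) :
  K \subset H -> T \subset K -> T != set0 ->
  {in cover K &, forall u v, connect (incidence K) (inl u) (inl v)} ->
  triple_system D T a x y -> k.*2 + 8 <= D -> b \in cover K ->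
  (forall e, e \in T -> exists q : seq (V + {set V}),
     [/\ size q = c.*2.+1, path (incidence H) (inl (a e)) (rcons q (inl b)),
         uniq q & {in q, forall z, ~~ node_of K z}]) ->
  berge_cycles_of_consecutive_lengths H k.
Proof.
move=> sKH sTK /set0Pn[e1 e1T] conn sysT le_D bK link.
have sTH := subset_trans sTK sKH.
have a1K : a e1 \in cover K.
  by apply/bigcupP; exists e1; [apply: (subsetP sTK) |
     case: (triple_mem sysT e1T)].
have [w [e0 [pre [path_pre last_pre uniq_pre [w_node first_pre]]]]] :
    exists w e0 (pre : seq (V + {set V})),
    [/\ path (incidence K) (inl b) pre, last (inl b) pre = inl w,
        uniq (inl b :: pre)
      & triple_node T a x y (inl w) /\
        {in inl b :: pre, forall z, triple_node T a x y z ->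
           z \in [set inl w; inr e0]}].
  have /connectP[p path_p last_p] := conn b (a e1) bK a1K.
  have [|q [path_q uniq_q node_q first_q]] :=
      first_hit (S := triple_node T a x y) path_p.
    by rewrite -last_p /= imset_f.
  case last_q : (last (inl b) q) node_q first_q => [w|e] node_q first_q.
    exists w, set0, q; split=> //; split=> // z zq /(first_q z zq)->.
    by rewrite !inE eqxx.
  have eT : e \in T := node_q.
  have nap : inl (a e) \notin inl b :: q.
    by apply/negP => /first_q; rewrite /= imset_f // => /(_ isT).
  exists (a e), e, (rcons q (inl (a e))); split.
  - rewrite rcons_path path_q last_q /= (subsetP sTK _ eT).
    by have [->] := triple_mem sysT eT.
  - by rewrite last_rcons.
  - by rewrite -rcons_cons rcons_uniq nap.
  split; first by rewrite /= imset_f.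
  move=> z; rewrite -rcons_cons mem_rcons inE => /orP[/eqP->|zq].
    by rewrite !inE eqxx.
  by move/(first_q z zq)->; rewrite !inE eqxx orbT.
have [h size_pre] : exists h, size pre = h.*2.
  exists (size pre)./2; rewrite -[LHS]odd_double_half.
  by have := incidence_path_parity path_pre; rewrite last_pre /= addbF => <-.
(* The other parts of the cycle take h + c + 1 steps, and the walk in the triple
   system can take any number n of steps from 2 to k + 1. *)
exists (h + c + 3) => l lt_l; pose n := l - (h + c + 1).
have [||p [v [[size_p path_p last_p] uniq_p avoid_p node_p vA]]] :=
    triple_walks (n := n) e0 sysT _ _ w_node.
- by rewrite /n; move: lt_l; clear; lia.
- by rewrite /n; move: lt_l le_D; clear; lia.
have /imsetP[e eT ve] := vA.
have [q [size_q path_q uniq_q out_q]] := link e eT; rewrite -ve in path_q.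
have inK z : z \in (inl b :: pre) ++ p -> node_of K z.
  rewrite mem_cat inE -orbA => /or3P[/eqP->//|zpre|zp].
    exact: incidence_path_nodes path_pre z zpre.
  exact: incidence_path_nodes (sub_path (incidence_sub sTK) path_p) z zp.
apply: (@berge_of_incidence_cycle V H l b (pre ++ p ++ q)).
- by move: lt_l; clear; lia.
- by rewrite !size_cat size_pre size_p size_q /n; move: lt_l; clear; lia.
- rewrite -cat_cons catA cat_uniq uniq_q andbT; apply/andP; split.
    rewrite cat_uniq uniq_pre uniq_p andbT; apply/hasPn => z zp.
    apply: contra (avoid_p z zp) => zpre; exact: first_pre (node_p z zp).
  by apply/hasPn => z /out_q; apply: contra => /inK.
rewrite /cycle !rcons_cat !cat_path last_pre last_p path_q andbT.
rewrite (sub_path (incidence_sub sKH) path_pre).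
by rewrite (sub_path (incidence_sub sTH) path_p).
Qed.

(** * Dense level slices and the proof *)

Lemma sum_card_double_count (I T : finType) (A : I -> {set T}) :
  \sum_i #|A i| = \sum_t #|[set i | t \in A i]|.
Proof.
transitivity (\sum_i \sum_t (t \in A i : nat)).
  by apply: eq_bigr => i _; rewrite -sum1_card big_mkcond.
rewrite exchange_big /=; apply: eq_bigr => t _.
rewrite -sum1_card [RHS]big_mkcond; apply: eq_bigr => i _.
by rewrite inE.
Qed.

(** Otherwise summing over the classes would give #|H| <= 2 * M * #|cover H|.
*)
Lemma dense_class (V : finType) (M n : nat) (H : {set {set V}})
    (L : 'I_n -> {set {set V}}) :
  M * (2 * #|cover H|) < #|H| -> (forall i, L i \subset H) ->
  (forall e, e \in H -> exists i, e \in L i) ->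
  (forall v, #|[set i | v \in cover (L i)]| <= 2) ->
  exists i, M * #|cover (L i)| < #|L i|.
Proof.
move=> dense_H sLH LH le2; apply/existsP; apply: contraTT dense_H.
rewrite negb_exists -leqNgt => /forallP sparse.
apply: (@leq_trans (\sum_i #|L i|)).
  rewrite sum_card_double_count -sum1_card big_mkcond; apply: leq_sum => e _.
  case: ifP => // /LH[i ei]; apply/card_gt0P; exists i; by rewrite inE.
apply: (@leq_trans (M * \sum_i #|cover (L i)|)).
  by rewrite big_distrr; apply: leq_sum => i _; rewrite leqNgt.
rewrite leq_mul2l sum_card_double_count; apply/orP; right.
rewrite mulnC -sum_nat_const [leqRHS]big_mkcond /=; apply: leq_sum => v _.
case: ifPn => [_|nvH]; first exact: le2.
rewrite leqn0 cards_eq0; apply/eqP/setP=> i; rewrite !inE.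
apply: contraNF nvH => /bigcupP[e /(subsetP (sLH i)) eH ve].
by apply/bigcupP; exists e.
Qed.

(** The incidence graph is bipartite, so an edge at level 2i + 1 has all its
vertices at levels 2i and 2i + 2, and a vertex is covered by at most two
slices. *)
Lemma dense_slice (V : finType) (M : nat) (H : {set {set V}}) (v0 : V) :
  M * (2 * #|cover H|) < #|H| -> v0 \in cover H ->
  {in cover H &, forall u v, connect (incidence H) (inl u) (inl v)} ->
  set0 \notin H ->
  exists (d : V + {set V} -> nat) (i : nat),
  let L := [set e in H | d (inr e) == i.*2.+1] in
  [/\ M * #|cover L| < #|L|,
      d (inl v0) = 0,
      forall u, connect (incidence H) (inl v0) u -> u != inl v0 ->
        exists p, [/\ incidence H p u, connect (incidence H) (inl v0) p
                    & d u = (d p).+1],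
      {in cover L, forall v, i.*2 <= d (inl v)}
    & {in L, forall e : {set V}, exists2 v, v \in e & d (inl v) = i.*2}].
Proof.
move=> dense_H v0H conn nH0.
have [d [d0 parent step]] := bfs_levels (incidence H) (inl v0).
have reachV v : v \in cover H -> connect (incidence H) (inl v0) (inl v).
  exact: conn.
have reachE e : e \in H -> connect (incidence H) (inl v0) (inr e).
  move=> eH; have [v ve] : exists v, v \in e.
    by apply/set0Pn; apply: contraNneq nH0 => <-.
  apply: connect_trans (reachV v _) (connect1 _); last by rewrite /= eH ve.
  by apply/bigcupP; exists e.
have parity u : connect (incidence H) (inl v0) u -> is_edge u = odd (d u).
  have [m] := ubnP (d u); elim: m u => // m IHm u lt_m reach_u.
  have [->|nu0] := eqVneq u (inl v0); first by rewrite d0.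
  have [p [pu reach_p du]] := parent u reach_u nu0.
  rewrite (incidence_alternates pu) du /= IHm //.
  by rewrite du in lt_m; lia.
have near e v : e \in H -> v \in e ->
    d (inr e) = (d (inl v)).+1 \/ d (inl v) = (d (inr e)).+1.
  move=> eH ve; have vH : v \in cover H by apply/bigcupP; exists e.
  have := step _ (inr e) (reachV v vH); rewrite /= eH ve => /(_ isT).
  have := step _ (inl v) (reachE e eH); rewrite /= eH ve => /(_ isT).
  have := parity _ (reachV v vH); have := parity _ (reachE e eH); rewrite /=.
  lia.
pose n := (\max_u d u).+1.
have lt_n u : d u < n by rewrite ltnS leq_bigmax.
pose L (i : 'I_n) := [set e in H | d (inr e) == i.*2.+1].
have [i dense_L] : exists i, M * #|cover (L i)| < #|L i|.
  apply: (dense_class dense_H).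
  - by move=> i; apply/subsetP=> e; rewrite inE => /andP[].
  - move=> e eH; have odd_d := parity _ (reachE e eH).
    have lt_i : (d (inr e))./2 < n by apply: leq_ltn_trans (lt_n (inr e)); lia.
    exists (Ordinal lt_i); rewrite inE eH /=; move: odd_d => /=; lia.
  move=> v; pose h := (d (inl v))./2.
  suff /subset_leq_card : [set i | v \in cover (L i)]
      \subset [set (inord h : 'I_n); inord h.-1].
    by move/leq_trans; apply; rewrite cards2; case: (_ != _).
  apply/subsetP=> i; rewrite !inE => /bigcupP[e].
  rewrite inE => /andP[eH /eqP de] ve.
  have := near e v eH ve; rewrite de => -[dv|dv].
    have -> : h = i by rewrite /h; lia.
    by rewrite inord_val eqxx.
  have -> : h.-1 = i by rewrite /h; lia.
  by rewrite inord_val eqxx orbT.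
exists d, i; split=> //.
  move=> v /bigcupP[e]; rewrite inE => /andP[eH /eqP de] ve.
  by have := near e v eH ve; rewrite de => -[[<-]|->] //; rewrite leqW ?leqW.
move=> e; rewrite inE => /andP[eH /eqP de].
have [|[v|f] [ve _ dv]] := parent (inr e) (reachE e eH) _.
- by [].
- exists v; last by move: dv; rewrite de => -[<-].
  by move: ve => /= /andP[].
by [].
Qed.

(** When all edges of K have the same lowest vertex there is nothing to fork.
Then this vertex is the mark of every edge, and a triple system is impossible
because its pairs (a e, x e) could not be distinct, so the dense star is the
only outcome. *)
Lemma dense_hypergraph_cycles (V : finType) (r k : nat) (H : {set {set V}}) :
  2 < r -> 0 < k -> uniform r H ->
  2 * (5 * k) ^ (r - 2) * (10 * k) * 6 * (2 * #|V|) < #|H| ->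
  berge_cycles_of_consecutive_lengths H k.
Proof.
(* m is the degree threshold of dense stars and D the degree needed in the
   triple system. The factor 6 pays for the three slots of each vertex and for
   keeping the marks on one side of the fork only, the last factor 2 for passing to one
   slice of the levels. *)
move=> r_gt2 k_gt0 unifH; set m := 2 * _; set D := 10 * k; set M := m * D * 6.
move=> dense_H.
have [|H1 sH1 [dense_H1 conn1]] := @dense_connected V (M * 2) H.
  by apply: leq_ltn_trans dense_H; rewrite -!mulnA !leq_mul2l max_card !orbT.
suff [a0 cyc] : berge_cycles_of_consecutive_lengths H1 k.
  by exists a0 => l /cyc; apply: contains_berge_cycle_sub.
rewrite -mulnA in dense_H1.
have unif1 : uniform r H1 by move=> e /(subsetP sH1)/unifH.
have n0 (S : {set {set V}}) : uniform r S -> set0 \notin S.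
  by move=> unifS; apply/negP => /unifS; rewrite cards0; lia.
have [v0 v0H] : exists v0, v0 \in cover H1.
  have [e eH] : exists e, e \in H1.
    by apply/card_gt0P; apply: leq_ltn_trans dense_H1.
  have [v ve] : exists v, v \in e by apply/card_gt0P; rewrite unif1 //; lia.
  by exists v; apply/bigcupP; exists e.
have [d [i]] := dense_slice dense_H1 v0H conn1 (n0 _ unif1).
set L := [set e in H1 | _] => -[dense_L d0 parent lowV lowE].
have [K sKL [dense_K connK]] := dense_connected dense_L.
have sLH1 : L \subset H1 by apply/subsetP=> e; rewrite inE => /andP[].
have sKH1 := subset_trans sKL sLH1.
have unifK : uniform r K by move=> e /(subsetP sKH1)/unif1.
have high z : node_of K z -> i.*2 <= d z.
  case: z => [v|e] /=.
    case/bigcupP=> e /(subsetP sKL) eL ve; apply: lowV.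
    by apply/bigcupP; exists e.
  by move/(subsetP sKL); rewrite inE => /andP[_ /eqP->].
pose Z : {set V + {set V}} := [set q | node_of K q & d q == i.*2].
have ZP q : q \in Z -> exists2 v, q = inl v & v \in cover K.
  rewrite inE; case: q => [v|e] /= /andP[]; first by exists v.
  by move=> /(subsetP sKL); rewrite inE => /andP[_ /eqP->]; lia.
pose a (e : {set V}) : V :=
    if [pick v in e | inl v \in Z] is Some v then v else v0.
have aP e : e \in K -> a e \in e /\ inl (a e) \in Z.
  move=> eK; rewrite /a; case: pickP => [v /andP[ve vZ]//|none].
  have [v ve dv] := lowE e (subsetP sKL e eK).
  suff vZ : inl v \in Z by have := none v; rewrite /= ve vZ.
  by rewrite inE dv eqxx andbT /=; apply/bigcupP; exists e.
have le_cov (S : {set {set V}}) : S \subset K -> #|cover S| <= #|cover K|.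
  move=> /subsetP sSK; apply/subset_leq_card/bigcupsP=> e /sSK eK.
  exact: (bigcup_sup e).
have star (S : {set {set V}}) : S \subset H1 ->
    (forall l, 2 < l < k + 3 -> contains_berge_cycle S l) ->
    berge_cycles_of_consecutive_lengths H1 k.
  move=> sSH cycS; exists 3 => l lt_l; apply: contains_berge_cycle_sub sSH _.
  by apply: cycS; move: lt_l; clear; lia.
have triples (S : {set {set V}}) : S \subset K -> #|K| <= 2 * #|S| ->
    berge_cycles_of_consecutive_lengths H1 k \/
    exists (T : {set {set V}}) (x y : {set V} -> V),
      [/\ T \subset S, T != set0 & triple_system D T a x y].
  move=> sSK le_S; have sSK' := subsetP sSK.
  have unifS : uniform r S by move=> e /sSK'/unifK.
  have [||cycS|] := @triples_of_marked_edges V r k D S a r_gt2 unifS.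
  - by move=> e /sSK'/aP[].
  - have : m * (D * (3 * #|cover S|)) <= m * (D * (3 * #|cover K|)).
      by rewrite !leq_mul2l le_cov ?orbT.
    have : m * (D * (3 * #|cover K|)) * 2 = M * #|cover K|.
      by rewrite /M -!mulnA; congr (_ * (_ * _)); clear; lia.
    rewrite -/m; move: (m * (D * (3 * #|cover K|))) (m * _) => p1 p2.
    move: dense_K le_S; move: (M * _) #|K| #|S| => p3 p4 p5; clear; lia.
  - by left; apply: star cycS; apply: subset_trans sKH1.
  - by right.
have main (A B : {set V + {set V}}) c :
    A \subset Z -> B \subset Z -> B != set0 ->
    {in A & B, forall u w, exists q,
       [/\ size q = c.*2.+1, path (incidence H1) u (rcons q w), uniq q
         & {in q, forall z, d z < i.*2}]} ->
    #|K| <= 2 * #|[set e in K | inl (a e) \in A]| ->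
    berge_cycles_of_consecutive_lengths H1 k.
  move=> sAZ sBZ /set0Pn[w wB] link le_K.
  have [|//|[T [x [y [sT T_neq0 sysT]]]]] := triples _ _ le_K.
    by apply/subsetP=> e; rewrite inE => /andP[].
  have [b wb bK] := ZP w (subsetP sBZ w wB); rewrite wb in wB.
  have sTK : T \subset K.
    by apply: subset_trans sT _; apply/subsetP=> e; rewrite inE => /andP[].
  apply: (cycles_from_triples (c := c) sKH1 sTK T_neq0 connK sysT _ bK).
    by rewrite /D; move: k_gt0; clear; lia.
  move=> e /(subsetP sT); rewrite inE => /andP[_ aA].
  have [q [size_q path_q uniq_q low_q]] := link _ _ aA wB.
  exists q; split=> // z /low_q; rewrite ltnNge; exact: contra (@high z).
have [Z_le1|Z_gt1] := leqP #|Z| 1.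
  have [|//|[T [x [y [sT T_neq0 sysT]]]]] := triples K (subxx _) _.
    by rewrite leq_pmull.
  have [e eT] := set0Pn _ T_neq0; have [_ x_deg _] := triple_degree sysT eT.
  suff /subset_leq_card : [set f in T | x f == x e] \subset [set e].
    by rewrite cards1 => /(leq_trans x_deg); rewrite /D;
       move: k_gt0; clear; lia.
  apply/subsetP=> f; rewrite !inE => /andP[fT /eqP eq_x].
  apply/eqP/(triple_inj sysT) => //.
  have [_ afZ] := aP f (subsetP sT f fT).
  have [_ aeZ] := aP e (subsetP sT e eT).
  have eq_a : inl (a f) = inl (a e) :> V + {set V}.
    by move/card_le1_eqP: Z_le1; apply.
  by case: eq_a.
have [|A [B [c [A_neq0 B_neq0 AB disAB link]]]] :=
    @level_fork _ (incidence H1) (inl v0) d i.*2 Z (incidence_sym H1) d0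
      parent _ Z_gt1.
  move=> q qZ; have [v qv vK] := ZP q qZ; rewrite qv in qZ *.
  move: qZ; rewrite inE => /andP[_ /eqP dq]; split=> //.
  apply: conn1 => //; case/bigcupP: vK => e /(subsetP sKH1) eH ve.
  by apply/bigcupP; exists e.
have sAZ : A \subset Z by rewrite -AB subsetUl.
have sBZ : B \subset Z by rewrite -AB subsetUr.
pose KA := [set e in K | inl (a e) \in A].
pose KB := [set e in K | inl (a e) \in B].
have le_K : #|K| <= #|KA| + #|KB|.
  apply: leq_trans (leq_card_setU _ _); apply/subset_leq_card/subsetP=> e eK.
  by rewrite !inE eK /=; have [_] := aP e eK; rewrite -AB inE.
have [le_BA|/ltnW le_AB] := leqP #|KB| #|KA|.
  by apply: (main A B c) => //;
     rewrite mul2n -addnn (leq_trans le_K) ?leq_add2l.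
apply: (main B A c) => //;
  last by rewrite mul2n -addnn (leq_trans le_K) ?leq_add2r.
move=> u w uB wA; have [q [size_q path_q uniq_q low_q]] := link w u wA uB.
exists (rev q); split; rewrite ?size_rev ?rev_uniq //.
  have := rev_path (incidence H1) w (rcons q u).
  rewrite last_rcons belast_rcons rev_cons => ->.
  by rewrite (eq_path (e' := incidence H1)) // => z t; rewrite incidence_sym.
by move=> z; rewrite mem_rev; apply: low_q.
Qed.

Lemma sum_degree (V : finType) (r : nat) (H : {set {set V}}) :
  uniform r H -> \sum_v degree H v = r * #|H|.
Proof.
move=> unifH; rewrite /degree sum_card_double_count mulnC -sum_nat_const.
rewrite [RHS]big_mkcond; apply: eq_bigr => e _.
have [/[dup] eH /unifH <-|neH] := ifPn.
  by apply: eq_card => v; rewrite !inE eH.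
by apply/eqP; rewrite cards_eq0; apply/eqP/setP=> v; rewrite !inE (negPf neH).
Qed.

Local Open Scope ring_scope.

Theorem theorem1p3 (R : realFieldType) (r : nat) (hr : (3 <= r)%N) :
  exists C : R, 0 < C /\
    forall k : nat, (1 <= k)%N ->
    forall (V : finType) (H : {set {set V}}),
      (0 < #|V|)%N ->
      uniform r H ->
      C * k%:R ^+ (r - 1) <= average_degree R H ->
      berge_cycles_of_consecutive_lengths H k.
Proof.
(* 240 = 2 * 10 * 6 * 2 collects the numerical factors. *)
pose c := (240 * 5 ^ (r - 2))%N.
exists (r * c.+1)%:R; split; first by rewrite ltr0n muln_gt0 (leq_trans _ hr).
move=> k k_gt0 V H V_gt0 unifH.
rewrite /average_degree -natr_sum (sum_degree unifH) ler_pdivlMr ?ltr0n //.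
rewrite -natrX -!natrM ler_nat -!mulnA leq_pmul2l ?(leq_trans _ hr) //.
move=> dense_H.
apply: (dense_hypergraph_cycles hr k_gt0 unifH).
have -> : (2 * (5 * k) ^ (r - 2) * (10 * k) * 6 * (2 * #|V|) =
    c * (k ^ (r - 1) * #|V|))%N.
  have -> : (r - 1 = (r - 2).+1)%N by move: hr; clear; lia.
  by rewrite /c expnMn expnS; ring.
apply: leq_trans dense_H; rewrite mulSn -{1}[(c * _)%N]add0n ltn_add2r.
by rewrite muln_gt0 expn_gt0 k_gt0.
Qed.
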